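(* Assume that $a,b,c$ are positive integers with $T(a,b,c)=7$, i.e. with $a^2+b^4+c^4+2ab^2+2ac^2=7ab^2c^2$. Then there exists a sequence $(k_1,\ldots,k_r)\in\{1,2,3\}^r$ of length $r\geq 0$ such that $(a,b,c)=(\mu_{k_r}\circ\cdots\circ\mu_{k_1})(1,1,1)$.
   Context: For nonzero $a,b,c$ put $$T(a,b,c)=\frac{a^2+b^4+c^4+2ab^2+2ac^2}{ab^2c^2}.$$ The maps $\mu_1,\mu_2,\mu_3$ on triples of positive rational numbers are defined by $$\mu_1(a,b,c)=\left(\tfrac{b^4+c^4}{a},b,c\right),\qquad \mu_2(a,b,c)=\left(a,\tfrac{a+c^2}{b},c\right),\qquad \mu_3(a,b,c)=\left(a,b,\tfrac{a+b^2}{c}\right).$$ For $r=0$ the composition is the identity map. *)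

(* Defs.v *)
From mathcomp Require Import all_boot all_order all_algebra.
Set Implicit Arguments.
Unset Strict Implicit.
Unset Printing Implicit Defensive.
Import Order.TTheory GRing.Theory Num.Theory.
Local Open Scope ring_scope.

Definition T (a b c : rat) : rat :=
  (a ^+ 2 + b ^+ 4 + c ^+ 4 + 2 * a * b ^+ 2 + 2 * a * c ^+ 2)
    / (a * b ^+ 2 * c ^+ 2).

(* The maps below are totalized on all rational triples using x / 0 = 0;
   by [mu_pos] they restrict to self-maps of the positive ones. *)
Definition triple : Type := (rat * rat * rat)%type.

Definition pos_triple (t : triple) : bool :=
  let: (a, b, c) := t in [&& 0 < a, 0 < b & 0 < c].

Definition mu1 (t : triple) : triple :=
  let: (a, b, c) := t in ((b ^+ 4 + c ^+ 4) / a, b, c).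

Definition mu2 (t : triple) : triple :=
  let: (a, b, c) := t in (a, (a + c ^+ 2) / b, c).

Definition mu3 (t : triple) : triple :=
  let: (a, b, c) := t in (a, b, (a + b ^+ 2) / c).

(* The index set {1, 2, 3} is 'I_3 shifted down by one. *)
Definition mu (k : 'I_3) : triple -> triple :=
  match val k with
  | 0 => mu1
  | 1 => mu2
  | _ => mu3
  end.

(* mu_comp [:: k_1; ...; k_r] is mu_{k_r} o ... o mu_{k_1}: the head of the
   sequence is applied first. *)
Fixpoint mu_comp (ks : seq 'I_3) : triple -> triple :=
  if ks is k :: ks' then mu_comp ks' \o mu k else id.

Lemma mu_pos (k : 'I_3) (t : triple) : pos_triple t -> pos_triple (mu k t).
Proof.
case: t => [[a b] c] /and3P[a0 b0 c0]; rewrite /mu.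
by case: (val k) => [|[|n]] /=; rewrite ?a0 ?b0 ?c0 ?divr_gt0 ?addr_gt0 ?exprn_gt0.
Qed.

(* Main.v *)
Require Import Defs.
From mathcomp Require Import all_boot all_order all_algebra.
From mathcomp Require Import zify.
Import Order.TTheory GRing.Theory Num.Theory.
Local Open Scope ring_scope.

(** The proof is Vieta jumping.  Clearing denominators, [T a b c = 7] is
    quadratic in [a] and, for fixed [a] and [c], quadratic in [b ^ 2] (and
    likewise in [c ^ 2]).  Replacing one of these roots by the other one is
    what [mu1], [mu2] and [mu3] do.  The second root in [a] is an integer
    because the sum of the roots is; the second root in [b ^ 2] is an integer
    which is the square of the rational number [(a + c ^ 2) / b], so this
    number is an integer as well.  Hence the jumps stay inside the positive
    integer solutions ([jump_a], [jump_b]).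

    Suppose that no jump makes a solution strictly smaller.  Then each of
    [x = a], [y = b ^ 2], [z = c ^ 2] is the smaller root of its quadratic.
    A monic quadratic is nonnegative to the left of its smaller root; evaluating the
    one of the largest variable at the second largest variable gives an
    inequality so restrictive that the solution is [(1, 1, 1)]
    ([minimal_solution]).  Thus every other solution has a jump decreasing
    [a + b + c], and since the maps are involutions, reversing the descent
    writes the solution as an image of [(1, 1, 1)]. *)

Definition solution (a b c : nat) : Prop :=
  (a ^ 2 + b ^ 4 + c ^ 4 + 2 * a * b ^ 2 + 2 * a * c ^ 2
   = 7 * a * b ^ 2 * c ^ 2)%N.

Lemma solution_swap (a b c : nat) : solution a b c -> solution a c b.
Proof. by rewrite /solution => sol; lia. Qed.

Lemma T_eq7_solution (a b c : nat) :
    (0 < a)%N -> (0 < b)%N -> (0 < c)%N ->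
  T a%:R b%:R c%:R = 7 -> solution a b c.
Proof.
move=> a0 b0 c0; rewrite /T => /(canRL (divfK _)) eqT.
apply/eqP; rewrite -(eqr_nat rat) !(natrD, natrM, natrX) eqT ?mulrA //.
by rewrite !mulf_neq0 ?expf_neq0 ?pnatr_eq0 -?lt0n.
Qed.

(** Two solutions exchanged by the jump in [a] are the roots of one quadratic,
    so their sum is [7 * b ^ 2 * c ^ 2 - 2 * b ^ 2 - 2 * c ^ 2]. *)
Lemma jump_a (a b c : nat) : (0 < a)%N -> solution a b c ->
  exists2 a' : nat, (a * a' = b ^ 4 + c ^ 4)%N & solution a' b c.
Proof.
rewrite /solution => a0 sol.
have /dvdnP[a' def_a'] : (a %| b ^ 4 + c ^ 4)%N.
  have dvd_rest : (a %| a * (a + 2 * b ^ 2 + 2 * c ^ 2))%N by exact: dvdn_mulr.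
  rewrite -(dvdn_addr _ dvd_rest); apply/dvdnP; exists (7 * b ^ 2 * c ^ 2)%N.
  by lia.
exists a'; first by rewrite mulnC.
have sum_roots : (a + a' + 2 * b ^ 2 + 2 * c ^ 2 = 7 * b ^ 2 * c ^ 2)%N.
  by apply/eqP; rewrite -(eqn_pmul2l a0); apply/eqP; lia.
by have := congr1 (muln a') sum_roots; lia.
Qed.

(** The roots of the quadratic in [b ^ 2] have product [(a + c ^ 2) ^ 2], so
    [b ^ 2] divides this square, and therefore [b] divides [a + c ^ 2]. *)
Lemma jump_b (a b c : nat) : (0 < b)%N -> solution a b c ->
  exists2 b' : nat, (b * b' = a + c ^ 2)%N & solution a b' c.
Proof.
rewrite /solution => b0 sol.
have /dvdnP[b' def_b'] : (b %| a + c ^ 2)%N.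
  rewrite -(@dvdn_pexp2r _ _ 2) //.
  have dvd_rest : (b ^ 2 %| b ^ 2 * (b ^ 2 + 2 * a))%N by exact: dvdn_mulr.
  rewrite -(dvdn_addr _ dvd_rest); apply/dvdnP; exists (7 * a * c ^ 2)%N.
  by lia.
exists b'; first by rewrite mulnC.
have def_sq : ((a + c ^ 2) ^ 2 = b ^ 2 * b' ^ 2)%N by rewrite def_b' expnMn mulnC.
have sum_roots : (b ^ 2 + b' ^ 2 + 2 * a = 7 * a * c ^ 2)%N.
  have b20 : (0 < b ^ 2)%N by rewrite expn_gt0 b0.
  by apply/eqP; rewrite -(eqn_pmul2l b20); apply/eqP; lia.
by have := congr1 (muln (b' ^ 2)) sum_roots; lia.
Qed.

(** The quadratic [X ^ 2 - (q - p) * X + m], with root [u] and hence second root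
    [m / u], is nonnegative to the left of [u] if [u] is the smaller root: [u]
    times its value at [t] is [(u - t) * (m - t * u)]. *)
Lemma quadratic_ge0_left (m p q t u : nat) :
    (0 < u)%N -> (t <= u)%N -> (u ^ 2 <= m)%N ->
    (u ^ 2 + p * u + m = q * u)%N ->
  (q * t <= t ^ 2 + p * t + m)%N.
Proof.
move=> u0 le_tu le_m root_u.
have le_tum : (t * u <= m)%N by apply: leq_trans le_m; rewrite leq_mul2r le_tu orbT.
rewrite -(leq_pmul2l u0) mulnCA [(u * t)%N]mulnC mulnCA -root_u.
have [d def_u] : exists d, (u = t + d)%N by exists (u - t)%N; lia.
have [e def_m] : exists e, (m = t * u + e)%N by exists (m - t * u)%N; lia.
by subst m; subst u; nia.
Qed.

(** The hypotheses [min_x] and [min_y] say that [x] and [y] are the smaller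
    roots of their quadratics. *)
Lemma minimal_roots (x y z : nat) :
    (0 < x)%N -> (0 < z)%N -> (z <= y)%N ->
    (x ^ 2 + y ^ 2 + z ^ 2 + 2 * x * y + 2 * x * z = 7 * x * y * z)%N ->
    (x ^ 2 <= y ^ 2 + z ^ 2)%N -> (y <= x + z)%N ->
  [/\ x = 1, y = 1 & z = 1]%N.
Proof.
move=> x0 z0 le_zy sol min_x min_y; have y0 := leq_trans z0 le_zy.
have [le_yx | lt_xy] := leqP y x.
  (* Here the value at [y] of the quadratic of [x] is
     [4 * y ^ 2 + 2 * y * z + z ^ 2 - 7 * y ^ 2 * z]. *)
  have := @quadratic_ge0_left (y ^ 2 + z ^ 2) (2 * y + 2 * z) (7 * y * z)
            y x x0 le_yx min_x ltac:(lia) => val_y.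
  have z1 : z = 1%N by nia.
  have y1 : y = 1%N by nia.
  by split=> //; nia.
have min_y2 : (y ^ 2 <= (x + z) ^ 2)%N by rewrite leq_sqr.
have value t le_ty := @quadratic_ge0_left ((x + z) ^ 2) (2 * x) (7 * x * z)
  t y y0 le_ty min_y2 ltac:(lia).
have [le_zx | lt_xz] := leqP z x.
  have val_x := value x (ltnW lt_xy).
  have z1 : z = 1%N by nia.
  have x1 : x = 1%N by nia.
  by split=> //; nia.
(* If [x] were the smallest variable, the value at [z] of the quadratic of [y]
   would be [x ^ 2 + 4 * x * z + 2 * z ^ 2 - 7 * x * z ^ 2], which is negative
   for [0 < x < z]. *)
have val_z := value z le_zy.
have : (x ^ 2 < x * z ^ 2)%N by nia.
have : (4 * x * z <= 4 * x * z ^ 2)%N by nia.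
have : (2 * z ^ 2 <= 2 * x * z ^ 2)%N by nia.
by nia.
Qed.

Lemma minimal_solution (a b c : nat) :
    (0 < a)%N -> (0 < b)%N -> (0 < c)%N -> solution a b c ->
    (a ^ 2 <= b ^ 4 + c ^ 4)%N -> (b ^ 2 <= a + c ^ 2)%N ->
    (c ^ 2 <= a + b ^ 2)%N ->
  [/\ a = 1, b = 1 & c = 1]%N.
Proof.
move=> a0 b0 c0; wlog le_cb : b c b0 c0 / (c <= b)%N.
  move=> sym sol min_a min_b min_c; have [le_cb | /ltnW le_bc] := leqP c b.
    exact: sym.
  have [] // := sym c b c0 b0 le_bc (solution_swap _ _ _ sol).
  by rewrite addnC.
move=> sol min_a min_b _.
have [||||||-> b1 c1] := @minimal_roots a (b ^ 2) (c ^ 2).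
- by [].
- by rewrite expn_gt0 c0.
- by rewrite leq_sqr.
- by move: sol; rewrite /solution; lia.
- by rewrite -!expnM.
- by [].
by split=> //; nia.
Qed.

Definition reachable (t : triple) : Prop :=
  exists ks : seq 'I_3, t = mu_comp ks (1, 1, 1).

Lemma mu_comp_rcons (ks : seq 'I_3) (k : 'I_3) (t : triple) :
  mu_comp (rcons ks k) t = mu k (mu_comp ks t).
Proof. by elim: ks t => //= l ks IHks t; rewrite IHks. Qed.

Lemma reachable_mu (k : 'I_3) (t : triple) : reachable t -> reachable (mu k t).
Proof. by case=> ks ->; exists (rcons ks k); rewrite mu_comp_rcons. Qed.

(** Descent on [a + b + c]: the jump that decreases it leads to a triple which
    [mu k] maps back, [mu k] being an involution. *)
Lemma solution_reachable (a b c : nat) :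
    (0 < a)%N -> (0 < b)%N -> (0 < c)%N -> solution a b c ->
  reachable (a%:R, b%:R, c%:R).
Proof.
have [n] := ubnP (a + b + c)%N.
elim: n a b c => // n IHn a b c lt_n a0 b0 c0 sol.
have div_root (u v m : nat) : (0 < u)%N -> (u * v = m)%N -> (0 < v)%N ->
    u%:R = m%:R / v%:R :> rat.
  by move=> u0 <- v0; rewrite natrM mulfK // pnatr_eq0 -lt0n.
have [min_a | max_a] := leqP (a ^ 2) (b ^ 4 + c ^ 4); last first.
  have [a' prod_a sol'] := jump_a _ _ _ a0 sol.
  have a'0 : (0 < a')%N by nia.
  have lt_a : (a' < a)%N by nia.
  rewrite (div_root _ _ _ a0 prod_a a'0) natrD !natrX.
  by apply: (reachable_mu 0 (a'%:R, b%:R, c%:R)); apply: IHn => //; lia.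
have [min_b | max_b] := leqP (b ^ 2) (a + c ^ 2); last first.
  have [b' prod_b sol'] := jump_b _ _ _ b0 sol.
  have b'0 : (0 < b')%N by nia.
  have lt_b : (b' < b)%N by nia.
  rewrite (div_root _ _ _ b0 prod_b b'0) natrD natrX.
  by apply: (reachable_mu 1 (a%:R, b'%:R, c%:R)); apply: IHn => //; lia.
have [min_c | max_c] := leqP (c ^ 2) (a + b ^ 2); last first.
  have [c' prod_c sol'] := jump_b _ _ _ c0 (solution_swap _ _ _ sol).
  have c'0 : (0 < c')%N by nia.
  have lt_c : (c' < c)%N by nia.
  rewrite (div_root _ _ _ c0 prod_c c'0) natrD natrX.
  apply: (reachable_mu 2 (a%:R, b%:R, c'%:R)); apply: IHn => //; first by lia.
  exact: solution_swap.
have [-> -> ->] := minimal_solution _ _ _ a0 b0 c0 sol min_a min_b min_c.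
by exists [::].
Qed.

Theorem theorem2p6 (a b c : nat)
    (ha : (0 < a)%N) (hb : (0 < b)%N) (hc : (0 < c)%N)
    (hT : T a%:R b%:R c%:R = 7) :
  exists (r : nat) (k : r.-tuple 'I_3),
    (a%:R, b%:R, c%:R) = mu_comp k (1, 1, 1).
Proof.
have [ks reach] : reachable (a%:R, b%:R, c%:R).
  by apply: solution_reachable => //; apply: T_eq7_solution.
by exists (size ks), (in_tuple ks).
Qed.
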